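(* Let $I\subset\mathbb{R}$ be a bounded interval and $(W_n)_{n\ge 1}$ a sequence of graphons in $\mathcal{W}_I$. Let $c_1,c_2$ be two lower threshold functions such that $c_1(q)q=h_1<h_2=c_2(q)q$ for all integers $q\ge 1$, for some constants $0\le h_1,h_2\le 1$. If for every $q\ge 1$ and every $J\in \mathrm{Sym}_q$ the sequence $(\mathcal{E}^{c_2(q)}(W_n,J))_{n\ge1}$ converges, then for every $q\ge 1$ and every $J\in\mathrm{Sym}_q$ the sequence $(\mathcal{E}^{c_1(q)}(W_n,J))_{n\ge1}$ also converges.
   Context: A graphon is a bounded measurable function $W:[0,1]^2\to\mathbb{R}$ with $W(x,y)=W(y,x)$; $\mathcal{W}_I$ is the set of graphons with values in the interval $I$. $\mathrm{Sym}_q$ is the set of symmetric $q\times q$ real matrices, $[q]=\{1,\dots,q\}$, and $\mathrm{Pd}_q$ is the set of probability distributions $\mathbf{a}=(a_1,\dots,a_q)$ on $[q]$. A $q$-fractional partition is a tuple $\rho=(\rho_1,\dots,\rho_q)$ of measurable functions $\rho_i:[0,1]\to[0,1]$ with $\sum_{i=1}^q\rho_i(x)=1$ for every $x\in[0,1]$. For a graphon $W$ and $J\in\mathrm{Sym}_q$ put $$\mathcal{E}_\rho(W,J)=-\sum_{i,j=1}^q J_{ij}\int_{[0,1]^2}\rho_i(x)\rho_j(y)W(x,y)\,dx\,dy .$$ For $\mathbf{a}\in\mathrm{Pd}_q$ let $\omega_{\mathbf{a}}$ be the set of $q$-fractional partitions $\rho$ with $\int_0^1\rho_i(x)\,dx=a_i$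 for all $i\in[q]$; the microcanonical ground state energy is $\mathcal{E}_{\mathbf{a}}(W,J)=\min_{\rho\in\omega_{\mathbf{a}}}\mathcal{E}_\rho(W,J)$. For a real number $0\le c\le 1/q$ let $A_c=\{\mathbf{a}\in\mathrm{Pd}_q: a_i\ge c,\ i=1,\dots,q\}$; the lower threshold ground state energy is $\mathcal{E}^{c}(W,J)=\inf_{\mathbf{a}\in A_c}\mathcal{E}_{\mathbf{a}}(W,J)$. A lower threshold function is a function $c$ from the positive integers to $[0,1]$ with $0\le c(q)\le 1/q$ for all $q$. *)

(* Defs.v *)
From HB Require Import structures.
From mathcomp Require Import all_boot all_order all_algebra.
From mathcomp Require Import all_classical all_reals all_analysis.
Set Implicit Arguments.
Unset Strict Implicit.
Unset Printing Implicit Defensive.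
Import Order.TTheory GRing.Theory Num.Theory.
Import numFieldNormedType.Exports.
Local Open Scope classical_set_scope.
Local Open Scope ring_scope.

Definition unit_interval (R : realType) : set R := `[0, 1]%classic.
Arguments unit_interval : clear implicits.

Definition unit_square (R : realType) : set (R * R) :=
  unit_interval R `*` unit_interval R.
Arguments unit_square : clear implicits.

(* Functions on [0,1] and [0,1]^2 are represented by total functions of which
   only the restriction to [0,1], resp. [0,1]^2, is constrained and used. *)
Definition graphon (R : realType) (W : R * R -> R) : Prop :=
  [/\ measurable_fun (unit_square R) W,
      [bounded W z | z in unit_square R] &
      forall x y : R, unit_interval R x -> unit_interval R y ->
        W (x, y) = W (y, x)].

Definition graphon_in (R : realType) (I : set R) (W : R * R -> R) : Prop :=
  graphon W /\ forall z : R * R, unit_square R z -> I (W z).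

Definition Sym (R : realType) (q : nat) : set 'M[R]_q :=
  [set J : 'M[R]_q | J^T = J].

Definition Pd (R : realType) (q : nat) : set ('I_q -> R) :=
  [set a : 'I_q -> R | (forall i, 0 <= a i) /\ \sum_(i < q) a i = 1].

Definition fractional_partition (R : realType) (q : nat) :
    set ('I_q -> R -> R) :=
  [set rho : 'I_q -> R -> R |
    [/\ forall i, measurable_fun (unit_interval R) (rho i),
        forall i x, unit_interval R x -> 0 <= rho i x <= 1 &
        forall x, unit_interval R x -> \sum_(i < q) rho i x = 1]].

Definition energy (R : realType) (q : nat) (rho : 'I_q -> R -> R)
    (W : R * R -> R) (J : 'M[R]_q) : R :=
  - \sum_(i < q) \sum_(j < q) J i j *
      \int[(lebesgue_measure \x lebesgue_measure)%E]_(z in unit_square R)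
        (rho i z.1 * rho j z.2 * W z).

Definition omega (R : realType) (q : nat) (a : 'I_q -> R) :
    set ('I_q -> R -> R) :=
  [set rho : 'I_q -> R -> R | fractional_partition rho /\
    forall i, \int[lebesgue_measure]_(x in unit_interval R) rho i x = a i].

(* The minimum over omega a, written as an infimum of reals: for a graphon W
   and a in Pd the set of energies is nonempty and bounded below, and its
   infimum is attained. *)
Definition microcanonical_gse (R : realType) (q : nat) (a : 'I_q -> R)
    (W : R * R -> R) (J : 'M[R]_q) : R :=
  inf [set energy rho W J | rho in omega a].

Definition Pd_ge (R : realType) (q : nat) (c : R) : set ('I_q -> R) :=
  [set a : 'I_q -> R | Pd a /\ forall i, c <= a i].

Definition lower_threshold_gse (R : realType) (q : nat) (c : R)
    (W : R * R -> R) (J : 'M[R]_q) : R :=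
  inf [set microcanonical_gse a W J | a in @Pd_ge R q c].

(* The value at q = 0 is left unconstrained. *)
Definition lower_threshold_function (R : realType) (c : nat -> R) : Prop :=
  forall q : nat, (0 < q)%N -> 0 <= c q <= 1 / q%:R.

(* Main.v *)
Require Import Defs.
From HB Require Import structures.
From mathcomp Require Import all_boot all_order all_algebra.
From mathcomp Require Import all_classical all_reals all_analysis.
From mathcomp Require Import measurable_realfun ring lra.
Import Order.TTheory GRing.Theory Num.Theory.
Import numFieldNormedType.Exports.
Local Open Scope classical_set_scope.
Local Open Scope ring_scope.

(** Refining the colours trades the threshold level [h1] for the larger level
[h2].  Map a palette of [p] colours onto the [q] given ones by
[f : 'I_p -> 'I_q] and pull the coupling [J] back along [f].  Merging the
colours of each fibre turns a partition into [p] parts into one into [q] parts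
with the same energy, and if every one of the [p] parts has mass at least
[h2 / p], then part [i] has mass at least [t i := k i * h2 / p], where [k i] is
the size of the fibre of [i].  When all fibres are nonempty, conversely, a
partition into [q] parts of masses at least [t i] is split evenly along the
fibres.  Hence the ground state energy of the pulled back coupling at level
[h2] is the one of [J] under the thresholds [t i], whose sum is [h2].

A distribution [a] with [a i >= h1 / q] always satisfies one such system of
thresholds with [t i >= h1 / q], up to rounding: move from the constant vector
[h1 / q], of sum [h1], towards [a], of sum [1], until the sum is [h2].  To make
room for rounding the [t i] to multiples of [h2 / p], the partition is first
blended with a constant one of weight [e] ([rounded_thresholds]), which moves
the energy by at most a constant times [e] ([energy_dist_le]); the constant is
uniform in the graphon because all values lie in one bounded interval.

So, with [p] large and [e] small, [lower_threshold_gse_mxsub_ge] and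
[lower_threshold_gse_mxsub_le] say that the level [h1] energy of [J] is within
a small error, uniform in [n], of the minimum of the level [h2] energies over
the finitely many maps [f] whose thresholds satisfy [t i >= h1 / q], and each of
these converges.  It is therefore a Cauchy
sequence. *)

(** * Integrals of bounded functions *)

Lemma integrable_bounded_by {d} {T : measurableType d} {R : realType}
    (mu : {measure set T -> \bar R}) (D : set T) (f : T -> R) (C : R) :
  measurable D -> (mu D < +oo)%E -> measurable_fun D f ->
  (forall x, D x -> `|f x| <= C) -> mu.-integrable D (EFin \o f).
Proof.
move=> mD Dfin mf fC; apply: measurable_bounded_integrable => //.
rewrite /bounded_near; near=> M => x Dx /=; apply: le_trans (fC x Dx) _.
by near: M; apply: nbhs_pinfty_ge; exact: num_real.
Unshelve. all: by end_near.
Qed.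

Lemma Rintegral_sum {d} {T : measurableType d} {R : realType}
    (mu : {measure set T -> \bar R}) (D : set T) (I : Type) (s : seq I)
    (P : pred I) (f : I -> T -> R) : measurable D ->
  (forall i, P i -> mu.-integrable D (EFin \o f i)) ->
  \int[mu]_(x in D) (\sum_(i <- s | P i) f i x) =
  \sum_(i <- s | P i) \int[mu]_(x in D) f i x.
Proof.
move=> mD fi; elim: s => [|i s IH].
  under eq_Rintegral do rewrite big_nil.
  by rewrite big_nil Rintegral_cst// mul0r.
under eq_Rintegral do rewrite big_cons.
rewrite big_cons; case: ifPn => // Pi.
rewrite RintegralD//; [by rewrite IH|exact: fi|].
have -> : EFin \o (fun x => \sum_(j <- s | P j) f j x) =
    (fun x => \sum_(j <- s | P j) (f j x)%:E)%E.
  by apply/funext => x /=; rewrite sumEFin.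
by apply: integrable_sum => // j Pj; exact: fi.
Qed.

Lemma normr_Rintegral_le {d} {T : measurableType d} {R : realType}
    (mu : {measure set T -> \bar R}) (D : set T) (f : T -> R) (C : R) :
  measurable D -> mu D = 1%E -> measurable_fun D f ->
  (forall x, D x -> `|f x| <= C) -> `|\int[mu]_(x in D) f x| <= C.
Proof.
move=> mD muD mf fC.
have Dfin : (mu D < +oo)%E by rewrite muD ltry.
have fi := integrable_bounded_by mu D f C mD Dfin mf fC.
apply: (le_trans (le_normr_Rintegral mD fi)).
have -> : C = \int[mu]_(_ in D) C by rewrite Rintegral_cst// muD mulr1.
apply: le_Rintegral => //; first exact: integrable_norm.
by apply: (@integrable_bounded_by _ _ _ _ _ _ `|C|).
Qed.

(** * The unit interval and the unit square *)

Section unit_sets.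
Variable R : realType.

Lemma measurable_unit_interval : measurable (unit_interval R).
Proof. exact: measurable_itv. Qed.

Lemma measurable_unit_square :
  measurable (unit_square R : set (measurableTypeR R * measurableTypeR R)).
Proof. by apply: measurableX; exact: measurable_unit_interval. Qed.

Lemma lebesgue_measure_unit_interval :
  (lebesgue_measure : {measure set (measurableTypeR R) -> \bar R})
    (unit_interval R) = 1%E.
Proof. by rewrite /= lebesgue_measure_itv/= lte01 oppr0 adde0. Qed.

Lemma lebesgue_measure_unit_square :
  (lebesgue_measure \x lebesgue_measure :
    {measure set (measurableTypeR R * measurableTypeR R) -> \bar R})%E
    (unit_square R) = 1%E.
Proof.
rewrite /= product_measure1E; [|exact: measurable_unit_interval..].
have h := lebesgue_measure_unit_interval.
exact: etrans (congr2 mule h h) (mule1 _).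
Qed.
End unit_sets.

(** * The energy as a single integral *)

Section energy.
Context {R : realType} {q : nat}.
Implicit Types (rho sigma : 'I_q -> R -> R) (J : 'M[R]_q).

(* Lebesgue measure lives on [measurableTypeR R], which is convertible to the
   canonical measurable structure of [R] but carries another display. *)
Local Notation T2 := (measurableTypeR R * measurableTypeR R)%type.
Local Notation mu2 :=
  (lebesgue_measure \x lebesgue_measure : {measure set T2 -> \bar R})%E.

(** The kernel that [W] is integrated against: merging colours and perturbing a
partition can then be handled pointwise, without splitting integrals. *)
Definition interaction rho J (z : R * R) : R :=
  \sum_(i < q) \sum_(j < q) J i j * (rho i z.1 * rho j z.2).

Lemma measurable_fp_pair rho i j : fractional_partition rho ->
  measurable_fun (T := T2) (unit_square R) (fun z => rho i z.1 * rho j z.2).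
Proof.
case=> mrho _ _; have mI := measurable_unit_interval R.
apply: measurable_funM.
- apply: (measurable_comp (F := unit_interval R) (f := rho i)
    (E := unit_square R)
    (g := @fst (measurableTypeR R) (measurableTypeR R))) => //;
    last exact: measurable_funS measurable_fst.
  by move=> _ [[x y] [? ?] <-].
- apply: (measurable_comp (F := unit_interval R) (f := rho j)
    (E := unit_square R)
    (g := @snd (measurableTypeR R) (measurableTypeR R))) => //;
    last exact: measurable_funS measurable_snd.
  by move=> _ [[x y] [? ?] <-].
Qed.

Lemma fp_pair_le1 rho i j z : fractional_partition rho -> unit_square R z ->
  `|rho i z.1 * rho j z.2| <= 1.
Proof.
case=> _ rho01 _ [z1 z2]; rewrite normrM.
have /andP[a0 a1] := rho01 i _ z1; have /andP[b0 b1] := rho01 j _ z2.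
by rewrite !ger0_norm// mulr_ile1.
Qed.

Lemma energyE rho W J : graphon W -> fractional_partition rho ->
  energy rho W J = - \int[mu2]_(z in unit_square R) (interaction rho J z * W z).
Proof.
move=> [mW [M [_ WM]] _] fprho; rewrite /energy; congr (- _).
have {}mW : measurable_fun (T := T2) (unit_square R) W := mW.
have {}WM z : unit_square R z -> `|W z| <= `|M| + 1.
  by apply: WM; rewrite ltr_pwDr// ler_norm.
have mD := measurable_unit_square R.
have D1 : mu2 (unit_square R) = 1%E := lebesgue_measure_unit_square R.
have Dfin : (mu2 (unit_square R) < +oo)%E by rewrite D1 ltry.
have int_pair i j : mu2.-integrable (unit_square R)
    (EFin \o (fun z => rho i z.1 * rho j z.2 * W z)).
  apply: (@integrable_bounded_by _ _ _ _ _ _ (`|M| + 1)) => //.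
    by apply: measurable_funM => //; exact: measurable_fp_pair.
  move=> z Dz; rewrite normrM -[leRHS]mul1r ler_pM//; last exact: WM.
  exact: fp_pair_le1.
have int_Jpair i j : mu2.-integrable (unit_square R)
    (EFin \o (fun z => J i j * (rho i z.1 * rho j z.2 * W z))).
  have := integrableZl mD (J i j) (int_pair i j).
  by apply: eq_integrable => // z _; rewrite /= EFinM.
rewrite (@eq_Rintegral _ _ _ mu2 _ (fun z => \sum_(i < q) \sum_(j < q)
    J i j * (rho i z.1 * rho j z.2 * W z))); last first.
  move=> z _; rewrite /interaction big_distrl; apply: eq_bigr => i _ /=.
  by rewrite big_distrl; apply: eq_bigr => j _ /=; rewrite -mulrA.
rewrite Rintegral_sum//; last first.
  move=> i _; have -> : EFin \o (fun z => \sum_(j < q)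
      J i j * (rho i z.1 * rho j z.2 * W z)) =
      (fun z => \sum_(j < q) (J i j * (rho i z.1 * rho j z.2 * W z))%:E)%E.
    by apply/funext => x /=; rewrite sumEFin.
  by apply: integrable_sum => // j _; exact: int_Jpair.
apply: eq_bigr => i _; rewrite Rintegral_sum//.
by apply: eq_bigr => j _; rewrite RintegralZl.
Qed.

(** * Bounds on the energy *)

Definition coupling_norm J : R := \sum_(i < q) \sum_(j < q) `|J i j|.

Lemma coupling_norm_ge0 J : 0 <= coupling_norm J.
Proof. by do 2 (apply: sumr_ge0 => ? _). Qed.

Lemma normr_coupling_sum_le J (A : 'I_q -> 'I_q -> R) (c : R) :
  (forall i j, `|A i j| <= c) ->
  `|\sum_(i < q) \sum_(j < q) J i j * A i j| <= c * coupling_norm J.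
Proof.
move=> Ac; rewrite /coupling_norm mulr_sumr.
apply: le_trans (ler_norm_sum _ _ _) _; apply: ler_sum => i _.
rewrite mulr_sumr; apply: le_trans (ler_norm_sum _ _ _) _.
by apply: ler_sum => j _; rewrite normrM mulrC ler_wpM2r.
Qed.

Lemma measurable_interaction rho J : fractional_partition rho ->
  measurable_fun (T := T2) (unit_square R) (interaction rho J).
Proof.
move=> fprho; apply: measurable_sum => i; apply: measurable_sum => j.
by apply: measurable_funM => //; exact: measurable_fp_pair.
Qed.

Lemma energy_ge rho W J (M : R) : graphon W ->
  (forall z, unit_square R z -> `|W z| <= M) -> fractional_partition rho ->
  - (coupling_norm J * M) <= energy rho W J.
Proof.
move=> gW WM fprho; rewrite energyE// lerN2.
apply: le_trans (ler_norm _) _; apply: normr_Rintegral_le.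
- exact: measurable_unit_square.
- exact: lebesgue_measure_unit_square.
- apply: measurable_funM; first exact: measurable_interaction.
  by case: gW.
move=> z Dz; rewrite normrM ler_pM//; last exact: WM.
rewrite -[leRHS]mul1r; apply: normr_coupling_sum_le => i j.
exact: fp_pair_le1.
Qed.

(** The interaction is quadratic with both factors in [[0, 1]], so replacing one
factor at a time costs at most [e] for each; only the uniform bound on [W]
enters, which makes the estimate uniform over a sequence of graphons. *)
Lemma energy_dist_le rho sigma W J (M e : R) : graphon W ->
  (forall z, unit_square R z -> `|W z| <= M) ->
  fractional_partition rho -> fractional_partition sigma ->
  (forall i x, unit_interval R x -> `|rho i x - sigma i x| <= e) ->
  `|energy rho W J - energy sigma W J| <= 2 * e * coupling_norm J * M.
Proof.
move=> gW WM fprho fpsigma rs; rewrite !energyE//.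
have mD := measurable_unit_square R.
have D1 : mu2 (unit_square R) = 1%E := lebesgue_measure_unit_square R.
have Dfin : (mu2 (unit_square R) < +oo)%E by rewrite D1 ltry.
have mW : measurable_fun (T := T2) (unit_square R) W by case: gW.
have mI tau : fractional_partition tau ->
    measurable_fun (T := T2) (unit_square R)
      (fun z => interaction tau J z * W z).
  by move=> fptau; apply: measurable_funM => //; exact: measurable_interaction.
have intI tau : fractional_partition tau ->
    mu2.-integrable (unit_square R)
      (EFin \o (fun z => interaction tau J z * W z)).
  move=> fptau.
  apply: (@integrable_bounded_by _ _ _ _ _ _ (coupling_norm J * M)).
  - exact: mD.
  - exact: Dfin.
  - exact: mI.
  move=> z Dz; rewrite normrM ler_pM//; last exact: WM.
  rewrite -[leRHS]mul1r; apply: normr_coupling_sum_le => i j.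
  exact: fp_pair_le1.
rewrite opprK addrC -RintegralB//; [|exact: intI..].
apply: normr_Rintegral_le => //; first by apply: measurable_funB; exact: mI.
move=> z Dz; rewrite -mulrBl normrM ler_pM//; last exact: WM.
rewrite /interaction -sumrB.
under eq_bigr do rewrite -sumrB.
under eq_bigr do under eq_bigr do rewrite -mulrBr.
apply: normr_coupling_sum_le => i j.
have [z1 z2] := Dz.
have -> : sigma i z.1 * sigma j z.2 - rho i z.1 * rho j z.2 =
  - (sigma i z.1 * (rho j z.2 - sigma j z.2)) -
    (rho i z.1 - sigma i z.1) * rho j z.2 by ring.
rewrite mulr_natl mulr2n; apply: le_trans (ler_normB _ _) _.
rewrite normrN !normrM.
have norm_le1 tau k x : fractional_partition tau -> unit_interval R x ->
    `|tau k x| <= 1.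
  by case=> _ tau01 _ /tau01 => /(_ k) /andP[? ?]; rewrite ger0_norm.
apply: lerD.
  by rewrite -[leRHS]mul1r ler_pM//; [exact: norm_le1|exact: rs].
by rewrite -[leRHS]mulr1 ler_pM//; [exact: rs|exact: norm_le1].
Qed.
End energy.

(** * Masses of the parts *)

Section mass.
Context {R : realType}.

Definition mass (g : R -> R) : R :=
  \int[lebesgue_measure]_(x in unit_interval R) g x.

Lemma mass_cst (c : R) : mass (fun=> c) = c.
Proof.
rewrite /mass Rintegral_cst; last exact: measurable_unit_interval.
by rewrite lebesgue_measure_unit_interval mulr1.
Qed.

Lemma fp_integrable {q : nat} (rho : 'I_q -> R -> R) i :
  fractional_partition rho ->
  lebesgue_measure.-integrable (unit_interval R) (EFin \o rho i).
Proof.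
case=> mrho rho01 _; apply: (@integrable_bounded_by _ _ _ _ _ _ 1).
- exact: measurable_unit_interval.
- by rewrite lebesgue_measure_unit_interval ltry.
- exact: mrho.
- by move=> x /(rho01 i) /andP[? ?]; rewrite ger0_norm.
Qed.

Lemma fp_mass_Pd {q : nat} (rho : 'I_q -> R -> R) :
  fractional_partition rho -> Pd (fun i => mass (rho i)).
Proof.
move=> fprho; split=> [i|].
  by apply: Rintegral_ge0 => x Ix; case: fprho => _ /(_ i x Ix) /andP[].
rewrite /mass -Rintegral_sum; first last.
- by move=> i _; exact: fp_integrable.
- exact: measurable_unit_interval.
rewrite -[RHS]mass_cst; apply: eq_Rintegral => x; rewrite inE => Ix.
by case: fprho => _ _; exact.
Qed.

Lemma fp_cst {q : nat} (a : 'I_q -> R) : Pd a ->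
  fractional_partition (fun i (_ : R) => a i).
Proof.
move=> [a0 a1]; split=> // i x _; rewrite a0 -a1 (bigD1 i)//= lerDl.
by apply: sumr_ge0.
Qed.

End mass.

(** * Ground state energies as infima over partitions *)

Section gse.
Context {R : realType} {q : nat}.
Variables (W : R * R -> R) (M : R) (J : 'M[R]_q).
Hypotheses (gW : graphon W) (WM : forall z, unit_square R z -> `|W z| <= M).

(** With [le_lower_threshold_gse], this collapses the two nested infima into the
infimum of the energy over all partitions whose parts have mass at least
[c]. *)
Lemma lower_threshold_gse_le_energy (c : R) (rho : 'I_q -> R -> R) :
  fractional_partition rho -> (forall i, c <= mass (rho i)) ->
  lower_threshold_gse c W J <= energy rho W J.
Proof.
move=> fprho crho.
have lbE a : lbound [set energy rho W J | rho in omega a]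
    (- (coupling_norm J * M)).
  by move=> _ [tau [fptau _] <-]; exact: energy_ge.
apply: (@le_trans _ _ (microcanonical_gse (fun i => mass (rho i)) W J)).
  apply: ge_inf.
    exists (- (coupling_norm J * M)) => _ [a [Pa _] <-].
    apply: lb_le_inf; last exact: lbE.
    exists (energy (fun i _ => a i) W J), (fun i _ => a i) => //.
    by split=> [|i]; [exact: fp_cst|exact: mass_cst].
  by exists (fun i => mass (rho i)) => //; split; [exact: fp_mass_Pd|].
apply: ge_inf; first by eexists; exact: lbE.
by exists rho.
Qed.

(** The bound on [c] makes the uniform distribution admissible; without it the
infimum would be that of the empty set, whose value is arbitrary. *)
Lemma le_lower_threshold_gse (c m : R) : (0 < q)%N -> c <= 1 / q%:R ->
  (forall rho : 'I_q -> R -> R, fractional_partition rho ->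
    (forall i, c <= mass (rho i)) -> m <= energy rho W J) ->
  m <= lower_threshold_gse c W J.
Proof.
move=> q0 cq mE; apply: lb_le_inf.
  exists (microcanonical_gse (fun=> 1 / q%:R) W J), (fun=> 1 / q%:R) => //.
  split=> //; split=> [i|]; first by rewrite divr_ge0.
  by rewrite sumr_const card_ord -[LHS]mulr_natr div1r mulVf// pnatr_eq0 -lt0n.
move=> _ [a [Pa ca] <-]; apply: lb_le_inf.
  exists (energy (fun i _ => a i) W J), (fun i _ => a i) => //.
  by split=> [|i]; [exact: fp_cst|exact: mass_cst].
move=> _ [rho [fprho massrho] <-]; apply: mE => // i.
by rewrite /mass massrho.
Qed.
End gse.

(** * Maps between colours with prescribed fibres *)

Definition fibre_size {p q : nat} (f : 'I_p -> 'I_q) (i : 'I_q) : nat :=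
  #|[pred u | f u == i]|.

Lemma sum_fibre_size {p q : nat} (f : 'I_p -> 'I_q) :
  (\sum_(i < q) fibre_size f i = p)%N.
Proof.
rewrite -[RHS]card_ord -sum1_card (partition_big f xpredT)//=.
by apply: eq_bigr => i _; rewrite sum1_card.
Qed.

(** List each colour [i] as often as demanded and read [f] off this list; the
indices beyond its end go to an arbitrary colour. *)
Lemma exists_large_fibres {p q : nat} (m : 'I_q -> nat) : (0 < q)%N ->
  (\sum_(i < q) m i <= p)%N ->
  exists f : {ffun 'I_p -> 'I_q}, forall i, (m i <= fibre_size f i)%N.
Proof.
move=> q0 mp; pose i0 := Ordinal q0.
pose s := flatten [seq nseq (m i) i | i <- enum 'I_q].
have sizes : size s = (\sum_(i < q) m i)%N.
  rewrite size_flatten /shape -map_comp sumnE big_map big_enum /=.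
  by apply: eq_bigr => i _; rewrite size_nseq.
have counts i : count_mem i s = m i.
  rewrite count_flatten -map_comp sumnE big_map big_enum /=.
  rewrite (bigD1 i)//= count_nseq /= eqxx mul1n big1 ?addn0// => j ji.
  by rewrite count_nseq /= (negbTE ji).
exists [ffun u => nth i0 s (val u)] => i.
rewrite -(counts i) /fibre_size cardE size_filter.
have -> : count [pred u | [ffun u => nth i0 s (val u)] u == i]
      (Finite.enum 'I_p) = count_mem i [seq nth i0 s k | k <- iota 0 p].
  rewrite -val_enum_ord -map_comp count_map enumT.
  by apply: eq_count => u /=; rewrite ffunE.
rewrite -(subnKC mp) -sizes iotaD map_cat count_cat.
by rewrite (_ : map _ (iota 0 _) = s) ?leq_addr//; exact: mkseq_nth.
Qed.

(** * Merging and splitting colours *)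

Section colour_maps.
Context {R : realType} {p q : nat}.
Variable f : 'I_p -> 'I_q.

Definition merge_colours (sigma : 'I_p -> R -> R) (i : 'I_q) (x : R) : R :=
  \sum_(u < p | f u == i) sigma u x.

Definition split_colours (rho : 'I_q -> R -> R) (u : 'I_p) (x : R) : R :=
  rho (f u) x / (fibre_size f (f u))%:R.

Lemma fp_merge sigma : fractional_partition sigma ->
  fractional_partition (merge_colours sigma).
Proof.
move=> [msigma sigma01 sigma1].
have sum1 x : unit_interval R x -> \sum_(i < q) merge_colours sigma i x = 1.
  by move=> Ix; rewrite -(sigma1 x Ix) (partition_big f xpredT).
have ge0 i x : unit_interval R x -> 0 <= merge_colours sigma i x.
  by move=> Ix; apply: sumr_ge0 => u _; case/andP: (sigma01 u x Ix).
split=> // [i|i x Ix].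
  rewrite (_ : merge_colours sigma i = fun x =>
      \sum_(u <- [seq u <- index_enum 'I_p | f u == i]) sigma u x); last first.
    by apply/funext => x; rewrite big_filter.
  exact: measurable_sum.
rewrite ge0//= -(sum1 x Ix) (bigD1 i)//= lerDl.
by apply: sumr_ge0 => j _; exact: ge0.
Qed.

Lemma mass_merge sigma i : fractional_partition sigma ->
  mass (merge_colours sigma i) = \sum_(u < p | f u == i) mass (sigma u).
Proof.
move=> fpsigma; rewrite /mass Rintegral_sum//.
  exact: measurable_unit_interval.
by move=> u _; exact: fp_integrable.
Qed.

(** Expanding the products of fibre sums and regrouping the terms by the pair of
merged colours: the coupling is constant on each pair of fibres. *)
Lemma interaction_merge sigma (J : 'M[R]_q) :
  interaction (merge_colours sigma) J = interaction sigma (mxsub f f J).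
Proof.
apply/funext => z; rewrite /interaction [RHS](partition_big f xpredT)//=.
apply: eq_bigr => i _.
transitivity (\sum_(u < p | f u == i) \sum_(j < q)
    \sum_(v < p | f v == j) J i j * (sigma u z.1 * sigma v z.2)).
  rewrite exchange_big/=; apply: eq_bigr => j _.
  rewrite /merge_colours mulr_suml mulr_sumr; apply: eq_bigr => u _.
  by rewrite mulr_sumr mulr_sumr.
apply: eq_bigr => u /eqP <-; rewrite [RHS](partition_big f xpredT)//=.
by apply: eq_bigr => j _; apply: eq_bigr => v /eqP <-; rewrite mxE.
Qed.

Lemma energy_merge sigma W (J : 'M[R]_q) : graphon W ->
  fractional_partition sigma ->
  energy (merge_colours sigma) W J = energy sigma W (mxsub f f J).
Proof.
move=> gW fpsigma; rewrite !energyE//; last exact: fp_merge.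
by rewrite interaction_merge.
Qed.

Hypothesis f_surj : forall i, (0 < fibre_size f i)%N.

Lemma fibre_size_neq0 i : (fibre_size f i)%:R != 0 :> R.
Proof. by rewrite pnatr_eq0 -lt0n. Qed.

Lemma split_coloursK rho : merge_colours (split_colours rho) = rho.
Proof.
apply/funext => i; apply/funext => x; rewrite /merge_colours /split_colours.
under eq_bigr => u /eqP -> do [].
by rewrite sumr_const -[LHS]mulr_natr divfK// fibre_size_neq0.
Qed.

Lemma fp_split rho : fractional_partition rho ->
  fractional_partition (split_colours rho).
Proof.
move=> [mrho rho01 rho1]; split=> [u|u x Ix|x Ix].
- by apply: measurable_funM.
- have /andP[r0 r1] := rho01 (f u) x Ix.
  rewrite divr_ge0//= ler_pdivrMr ?ltr0n// mul1r (le_trans r1)//.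
  by rewrite ler1n.
- by rewrite (partition_big f xpredT)//= -(rho1 x Ix)
    -[in RHS](split_coloursK rho).
Qed.

Lemma mass_split rho u : fractional_partition rho ->
  mass (split_colours rho u) = mass (rho (f u)) / (fibre_size f (f u))%:R.
Proof.
move=> fprho; rewrite /mass RintegralZr//.
  exact: measurable_unit_interval.
exact: fp_integrable.
Qed.

End colour_maps.

(** * Blending with a constant partition *)

Section blend.
Context {R : realType} {q : nat}.
Variables (e : R) (rho : 'I_q -> R -> R) (b : 'I_q -> R).
Hypotheses (e01 : 0 <= e <= 1) (fprho : fractional_partition rho) (Pb : Pd b).

Definition blend (i : 'I_q) (x : R) : R := (1 - e) * rho i x + e * b i.

Lemma Pd_le1 i : 0 <= b i <= 1.
Proof.
have [b0 b1] := Pb; rewrite b0 -b1 (bigD1 i)//= lerDl.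
by apply: sumr_ge0.
Qed.

Lemma fp_blend : fractional_partition blend.
Proof.
have [mrho rho01 rho1] := fprho; split=> [i|i x Ix|x Ix].
- by apply: measurable_funD => //; apply: measurable_funM.
- have /andP[r0 r1] := rho01 i x Ix; have /andP[b0 b1] := Pd_le1 i.
  have /andP[e0 e1] := e01.
  by apply/andP; split; rewrite /blend; nra.
- rewrite big_split/= -!mulr_sumr rho1//.
  by case: Pb => _ ->; ring.
Qed.

Lemma mass_blend i : mass (blend i) = (1 - e) * mass (rho i) + e * b i.
Proof.
have mI : measurable (unit_interval R : set (measurableTypeR R)).
  exact: measurable_unit_interval.
have irho := fp_integrable rho i fprho.
rewrite -[X in _ + X]mass_cst /mass -RintegralZl// -RintegralD//.
  have := integrableZl mI (1 - e) irho.
  by apply: eq_integrable => // x _; rewrite /= EFinM.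
apply: (@integrable_bounded_by _ _ _ _ _ _ `|e * b i|) => //.
by rewrite lebesgue_measure_unit_interval ltry.
Qed.

Lemma blend_close i x : unit_interval R x -> `|blend i x - rho i x| <= e.
Proof.
move=> Ix; have [_ /(_ i x Ix)/andP[r0 r1] _] := fprho.
have /andP[b0 b1] := Pd_le1 i.
rewrite (_ : _ - _ = e * (b i - rho i x)); last by rewrite /blend; ring.
have /andP[e0 _] := e01.
rewrite normrM ger0_norm// -[leRHS]mulr1 ler_wpM2l// ler_norml; lra.
Qed.
End blend.

(** * Comparing thresholds through a colour map *)

Section thresholds.
Context {R : realType} {p q : nat}.
Variables (W : R * R -> R) (M : R) (J : 'M[R]_q) (f : 'I_p -> 'I_q).
Hypotheses (gW : graphon W) (WM : forall z, unit_square R z -> `|W z| <= M).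

(** Merging an admissible partition for the fine palette adds up its masses over
each fibre, so the result is admissible for the coarse one. *)
Lemma lower_threshold_gse_mxsub_ge (c d : R) :
  (0 < p)%N -> d <= 1 / p%:R ->
  (forall i, c <= (fibre_size f i)%:R * d) ->
  lower_threshold_gse c W J <= lower_threshold_gse d W (mxsub f f J).
Proof.
move=> p0 dp cd; apply: le_lower_threshold_gse => // sigma fpsigma dsigma.
rewrite -energy_merge//; apply: (lower_threshold_gse_le_energy W M) => //.
  exact: fp_merge.
move=> i; rewrite mass_merge//; apply: le_trans (cd i) _.
by rewrite mulr_natl -sumr_const; apply: ler_sum => u _; exact: dsigma.
Qed.

(** The blend of [rho] with [b] has enough mass to be split evenly along the
fibres, and it stays within [e] of [rho] pointwise, hence close in energy. *)
Lemma lower_threshold_gse_mxsub_le (d e : R) (rho : 'I_q -> R -> R)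
    (b : 'I_q -> R) :
  0 <= e <= 1 -> fractional_partition rho -> Pd b ->
  (forall i, (0 < fibre_size f i)%N) ->
  (forall i, (fibre_size f i)%:R * d <= (1 - e) * mass (rho i) + e * b i) ->
  lower_threshold_gse d W (mxsub f f J) <=
    energy rho W J + 2 * e * coupling_norm J * M.
Proof.
move=> e01 fprho Pb f_surj fd; pose tau := blend e rho b.
have fptau : fractional_partition tau by exact: fp_blend.
have fps := fp_split f f_surj tau fptau.
apply: (@le_trans _ _ (energy tau W J)).
  rewrite -[in leRHS](split_coloursK f f_surj tau) energy_merge//.
  apply: (lower_threshold_gse_le_energy W M) => // u.
  by rewrite mass_split// ler_pdivlMr ?ltr0n// mulrC mass_blend.
rewrite -lerBlDl; apply: le_trans (ler_norm _) _.
by apply: energy_dist_le => // i x Ix; exact: blend_close.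
Qed.
End thresholds.

(** * Choosing the colour map *)

(** The thresholds [t] lie on the segment from the constant vector [h1 / q] to
[x = (1 - e) a + e / q], at the point where the sum is [h2]; since [x] exceeds
[h1 / q] by a margin proportional to [e], so does [t].  The distribution [b] is
whatever makes the blended masses equal to [x] plus the rounding error
[T - t].  Only the downward errors matter, and these are below [1 / p], hence
absorbed by the margin; total sums agree because both [t] and [T] add up to
[h2]. *)
Lemma rounded_thresholds {R : realType} (p q : nat) (h1 h2 e : R)
    (a : 'I_q -> R) :
  (0 < p)%N -> (0 < q)%N -> 0 <= h1 -> h1 < h2 -> h2 <= 1 -> 0 < e -> e <= 1 ->
  p%:R^-1 < e * (h2 - h1) / q%:R ->
  Pd a -> (forall i, h1 / q%:R <= a i) ->
  exists (f : {ffun 'I_p -> 'I_q}) (b : 'I_q -> R), Pd b /\ forall i,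
    [/\ h1 / q%:R <= (fibre_size f i)%:R * (h2 / p%:R),
        (0 < fibre_size f i)%N &
        (fibre_size f i)%:R * (h2 / p%:R) <= (1 - e) * a i + e * b i].
Proof.
move=> p0 q0 h10 h12 h21 e0 e1 p_large [a0 a1] ha.
have h20 : 0 < h2 by exact: le_lt_trans h12.
pose u : R := q%:R^-1; pose v : R := p%:R^-1.
have qu : q%:R * u = 1 by rewrite mulfV// pnatr_eq0 -lt0n.
have pv : p%:R * v = 1 by rewrite mulfV// pnatr_eq0 -lt0n.
have u0 : 0 < u by rewrite invr_gt0 ltr0n.
have v0 : 0 < v by rewrite invr_gt0 ltr0n.
have sum_cst (c : R) : \sum_(i < q) c = q%:R * c.
  by rewrite sumr_const card_ord mulr_natl.
(* The position on the segment at which the sum grows from [h1] to [h2]. *)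
pose lam := (h2 - h1) / (1 - h1).
have h11 : 0 < 1 - h1 by rewrite subr_gt0; exact: lt_le_trans h21.
have lamE : lam * (1 - h1) = h2 - h1 by rewrite divfK// gt_eqF.
have lam0 : 0 < lam by rewrite divr_gt0// subr_gt0.
have lam1 : lam <= 1 by rewrite ler_pdivrMr// mul1r lerD2r.
pose x i := (1 - e) * a i + e * u.
pose t i := h1 * u + lam * (x i - h1 * u).
have sum_t : \sum_(i < q) t i = h2.
  rewrite big_split/= sum_cst -mulr_sumr sumrB sum_cst.
  rewrite big_split/= sum_cst -mulr_sumr a1.
  have -> : q%:R * (h1 * u) = h1 by rewrite mulrCA qu mulr1.
  have -> : q%:R * (e * u) = e by rewrite mulrCA qu mulr1.
  have -> : (1 - e) * 1 + e = 1 by ring.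
  by rewrite lamE; ring.
have x_ge i : h1 * u + e * (1 - h1) * u <= x i.
  by have := ha i; rewrite -/u /x => ?; nra.
have t_ge i : h1 * u + e * (h2 - h1) * u <= t i.
  have -> : e * (h2 - h1) * u = lam * (e * (1 - h1) * u) by rewrite -lamE; ring.
  by rewrite lerD2l ler_pM2l// lerBrDl.
have t_le_x i : t i <= x i.
  rewrite /t -lerBrDl ler_piMl// subr_ge0; apply: le_trans (x_ge i).
  by rewrite lerDl !mulr_ge0// ltW.
pose m i := Num.truncn (p%:R * t i / h2).
have t0 i : 0 <= t i.
  apply: le_trans (t_ge i).
  by rewrite addr_ge0 ?mulr_ge0// ?subr_ge0 ltW.
have m_itv i : (m i)%:R <= p%:R * t i / h2 < (m i).+1%:R.
  by apply: truncn_itv; rewrite divr_ge0 ?mulr_ge0// ltW.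
have mp : (\sum_(i < q) m i <= p)%N.
  rewrite -(ler_nat R) natr_sum.
  have -> : p%:R = \sum_(i < q) (p%:R * t i / h2) :> R.
    by rewrite -mulr_suml -mulr_sumr sum_t mulfK// gt_eqF.
  by apply: ler_sum => i _; case/andP: (m_itv i).
have [f mf] := exists_large_fibres _ q0 mp.
pose T i : R := (fibre_size f i)%:R * (h2 * v).
have sum_T : \sum_(i < q) T i = h2.
  by rewrite -mulr_suml -natr_sum sum_fibre_size mulrCA pv mulr1.
have T_gt i : t i - v < T i.
  have /andP[_] := m_itv i; rewrite ltr_pdivrMr// -natr1 => mi.
  have : (m i)%:R <= (fibre_size f i)%:R :> R by rewrite ler_nat.
  move=> mfi.
  have : p%:R * t i < ((fibre_size f i)%:R + 1) * h2.
    by apply: lt_le_trans mi _; rewrite ler_pM2r// lerD2r.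
  rewrite -(ltr_pM2r v0) mulrAC pv mul1r /T => h.
  have : v * h2 <= v by rewrite ler_piMr// ltW.
  move: h; lra.
have vlt : v < e * (h2 - h1) * u by [].
have T_gt_h1 i : h1 * u < T i by have := T_gt i; have := t_ge i; lra.
(* Solving (1 - e) a + e b = x + (T - t) for [b]. *)
exists f, (fun i => u + (T i - t i) / e); split.
  split=> [i|].
    rewrite -(pmulr_rge0 _ e0) mulrDr mulrCA divff ?gt_eqF// mulr1.
    have : e * (h2 - h1) * u <= e * u.
      by rewrite ler_pM2r// -[leRHS]mulr1 ler_pM2l//; lra.
    by have := T_gt i; lra.
  by rewrite big_split/= sum_cst qu -mulr_suml sumrB sum_T sum_t subrr
    mul0r addr0.
move=> i; split.
- exact: ltW (T_gt_h1 i).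
- rewrite lt0n; apply/eqP => k0; have := T_gt_h1 i; rewrite /T k0 mul0r ltNge.
  by rewrite mulr_ge0// ltW.
rewrite -/v -/(T i) mulrDr [e * (_ / e)]mulrCA divff ?gt_eqF// mulr1.
by have := t_le_x i; rewrite /x; lra.
Qed.

(** * Convergence *)

Theorem theorem3p2 (R : realType) (I : set R) (W : nat -> R * R -> R)
    (c1 c2 : nat -> R) (h1 h2 : R)
    (I_interval : is_interval I) (I_bounded : bounded_set I)
    (W_graphon : forall n : nat, (0 < n)%N -> graphon_in I (W n))
    (c1_threshold : lower_threshold_function c1)
    (c2_threshold : lower_threshold_function c2)
    (h1_bounds : 0 <= h1 <= 1) (h2_bounds : 0 <= h2 <= 1)
    (h1_lt_h2 : h1 < h2)
    (c1_eq : forall q : nat, (0 < q)%N -> c1 q * q%:R = h1)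
    (c2_eq : forall q : nat, (0 < q)%N -> c2 q * q%:R = h2) :
  (forall (q : nat) (J : 'M[R]_q), (0 < q)%N -> Sym J ->
     cvgn (fun n : nat => lower_threshold_gse (c2 q) (W n) J)) ->
  forall (q : nat) (J : 'M[R]_q), (0 < q)%N -> Sym J ->
    cvgn (fun n : nat => lower_threshold_gse (c1 q) (W n) J).
Proof.
move=> cvg2 q J q0 symJ.
have [M M0 WM] : exists2 M : R, 0 < M & forall n z, (0 < n)%N ->
    unit_square R z -> `|W n z| <= M.
  have [M [_ IM]] := I_bounded; exists (`|M| + 1); first by rewrite ltr_wpDl.
  move=> n z n0 Dz; apply: IM; first by rewrite ltr_pwDr// ler_norm.
  by case: (W_graphon n n0) => _; exact.
have gW n : (0 < n)%N -> graphon (W n) by move=> /W_graphon[].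
have c1E : c1 q = h1 / q%:R.
  by rewrite -(c1_eq q q0) mulfK// pnatr_eq0 -lt0n.
have c1_le : c1 q <= 1 / q%:R by case/andP: (c1_threshold q q0).
have [h10 _] := andP h1_bounds; have [_ h21] := andP h2_bounds.
apply/cauchy_cvgP/cauchy_exP => eps eps0.
pose K := coupling_norm J * M.
have K0 : 0 <= K by rewrite mulr_ge0 ?coupling_norm_ge0// ltW.
(* Chosen so that blending costs at most [eps / 4]; the two comparisons of fine
   energies with their limits cost another [eps / 4]. *)
pose e := Num.min 1 (eps / (8 * (K + 1))).
have e0 : 0 < e by rewrite lt_min ltr01 divr_gt0// mulr_gt0// ltr_wpDl.
have e1 : e <= 1 by rewrite ge_min lexx.
have eK : 2 * e * coupling_norm J * M <= eps / 4.
  rewrite -mulrA -/K.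
  have : e <= eps / (8 * (K + 1)) by rewrite ge_min lexx orbT.
  by rewrite ler_pdivlMr ?mulr_gt0 ?ltr_wpDl// => ?; nra.
pose y := e * (h2 - h1) / q%:R.
have y0 : 0 < y by rewrite divr_gt0 ?ltr0n// mulr_gt0// subr_gt0.
pose p := (Num.truncn y^-1).+1.
have p_large : p%:R^-1 < y.
  by rewrite invf_plt ?posrE ?ltr0n//; exact: truncnS_gt.
have p0 : (0 < p)%N by [].
have c2E : c2 p = h2 / p%:R.
  by rewrite -(c2_eq p p0) mulfK// pnatr_eq0 -lt0n.
have c2_le : c2 p <= 1 / p%:R by case/andP: (c2_threshold p p0).
(* There are finitely many maps [f], so the convergence of [v f] to its limit is
   uniform in [f]. *)
pose v (f : {ffun 'I_p -> 'I_q}) n :=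
  lower_threshold_gse (c2 p) (W n) (mxsub f f J).
have v_cvg f : \forall n \near \oo, `|limn (v f) - v f n| < eps / 8.
  apply: cvgr_dist_lt; last by rewrite divr_gt0.
  by apply: cvg2 => //; rewrite /Sym/= trmx_mxsub symJ.
have v_near : \forall n \near \oo,
    (forall f, `|limn (v f) - v f n| < eps / 8) /\ (0 < n)%N.
  near=> n; split; near: n; first exact: filter_forall.
  exact: nbhs_infty_gt.
pose u n := lower_threshold_gse (c1 q) (W n) J.
(* The map [f] depends on the partition that nearly realises [u n], which is
   why closeness at [n] and [m] is demanded for all maps at once. *)
have u_le n m : (0 < n)%N -> (0 < m)%N ->
    (forall f, `|limn (v f) - v f n| < eps / 8) ->
    (forall f, `|limn (v f) - v f m| < eps / 8) ->
    u m - eps / 2 <= u n.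
  move=> n0 m0 vn vm.
  apply: le_lower_threshold_gse => // rho fprho rhoc.
  rewrite c1E in rhoc.
  have [f [b [Pb fb]]] := rounded_thresholds p q h1 h2 e _ p0 q0 h10
    h1_lt_h2 h21 e0 e1 p_large (fp_mass_Pd _ fprho) rhoc.
  have um : u m <= v f m.
    apply: (lower_threshold_gse_mxsub_ge _ M) => // [|z|i].
    - exact: gW.
    - exact: WM.
    - by rewrite c1E c2E; case: (fb i).
  have vE : v f n <= energy rho (W n) J + 2 * e * coupling_norm J * M.
    apply: (lower_threshold_gse_mxsub_le _ _ _ _ _ _ _ _ _ b) => //.
    - exact: gW.
    - by move=> z; exact: WM.
    - by rewrite ltW.
    - by move=> i; case: (fb i).
    - by move=> i; rewrite c2E; case: (fb i).
  have := vn f; have := vm f; rewrite !ltr_norml => /andP[? ?] /andP[? ?].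
  lra.
have [n [vn n0]] := filter_ex v_near.
exists (u n); rewrite /fmap/=; apply: filterS v_near => m [vm m0].
rewrite -ball_normE /ball_/= -/(u m).
have := u_le n m n0 m0 vn vm; have := u_le m n m0 n0 vm vn.
rewrite ltr_norml; lra.
Unshelve. all: by end_near. Qed.
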